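(* Let $I=\int_{[0,1]^{d_1}}f\left(\int_{[0,1]^{d_2}}g(\boldsymbol y,\boldsymbol x)\,\mathrm d\boldsymbol x\right)\mathrm d\boldsymbol y$. Let $f\circ\bar g$ have bounded generalized Hardy--Krause variation $V_{\mathrm{GHK}}$ of order one. Assume moreover that $|f''|$ and $|f'''|$ are monotonic and that the following hold. (1) There exist $0<b<\infty$ and $A_i>0$, $1\le i\le d_1$, $\max_iA_i<1/2$, such that $\tilde f=f(\bar g_h)$ satisfies $\left|\frac{\partial^{|u|}\tilde f}{\prod_{j\in u}\partial z_j}(\boldsymbol z)\right|\le b\prod_{i=1}^{d_1}\min(z_i,1-z_i)^{-A_i-\mathbf 1\{i\in u\}}$ for all $\boldsymbol z\in(0,1)^{d_1}$ and all $u\subseteq\{1,\dots,d_1\}$. (2) $\left|\int_{[0,1]^{d_1}}f(\bar g_h(\boldsymbol y))\,\mathrm d\boldsymbol y-I\right|\le C_{\mathrm{disc}}h^{\eta}$ with $\eta>0$ and $C_{\mathrm{disc}}>0$ independent of $h$, and the work of evaluating $g_h$ is $\mathcal O(h^{-\gamma})$ for some $\gamma>0$. (3) There exist $0<\delta_K<1$ and $1\le p\le\infty$ such that $f(K\bar g_h(\cdot))\in W^{3,p}([0,1]^{d_1})$ for all $K\in(1-\delta_K,1+\delta_K)$. (4) There exists $0\le k<\infty$ such that $\sup_{\boldsymbol y\in[0,1]^{d_1}}\left|V_{\mathrm{GHK}}(g_h(\boldsymbol y,\cdot))/\bar g_h(\boldsymbol y)\right|\le k$ as $h\to0$, and $\bar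 g_h\in L^{3q}([0,1]^{d_1})$ for some $1\le q\le\infty$ with $1/p+1/q=1$, $p$ as in (3). (5) There exist $0<\delta_K'<1$ and $1\le p'\le\infty$ such that, as $h\to0$, $f(K\bar g_h(\cdot))\in W^{2,2p'}([0,1]^{d_1})$ for all $K\in(1-\delta_K',1+\delta_K')$. (6) The bound on $V_{\mathrm{GHK}}(g_h(\boldsymbol y,\cdot))/\bar g_h(\boldsymbol y)$ in (4) holds, and $\bar g_h\in L^{4q'}([0,1]^{d_1})$ for some $1\le q'\le\infty$ with $1/p'+1/q'=1$, $p'$ as in (5). Then the total work of the optimized rDLQMC estimator (see context) based on the Sobol' sequence with Owen's scrambling for a specified error tolerance $TOL>0$ is $$W^{*}_{\mathrm{rDLQ}}=\mathcal O\left(TOL^{-\left(\frac{2}{3-2\epsilon}+\frac{4-4\epsilon}{(3-2\epsilon)^2}+\frac{\gamma}{\eta}\right)}\right)\qquad\text{as }TOL\to0,$$ for any (sufficiently small) $\epsilon>0$, where the constant implied by the $\mathcal O$ notation approaches infinity as $\epsilon\to0$.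
   Context: Here $d_1,d_2$ are positive integers, $f:\mathbb R\to\mathbb R$ is nonlinear, $g:[0,1]^{d_1}\times[0,1]^{d_2}\to\mathbb R$, and for a discretization parameter $h>0$, $g_h$ is an approximation of $g$ on the same domain, with $\bar g_h(\boldsymbol y)=\int_{[0,1]^{d_2}}g_h(\boldsymbol y,\boldsymbol x)\,\mathrm d\boldsymbol x$; the subscript $h$ is often dropped, so $\bar g$ denotes the inner integral of the integrand used in the estimator. The relevant moments of $\bar g_h$ and of its compositions with derivatives of $f$ are assumed to stay finite as $h\to0$. Generalized Hardy--Krause variation of order one. For $\varphi:[0,1]^d\to\mathbb R$ let $V^{(d)}(\varphi)=\left(\int_{[0,1]^d}\left|\frac{\partial^d\varphi}{\partial z_1\cdots\partial z_d}(\boldsymbol z)\right|^2\mathrm d\boldsymbol z\right)^{1/2}$; for $\mathfrak u\subseteq\{1,\dots,d\}$ let $\varphi_{\mathfrak u}(\boldsymbol z_{\mathfrak u})=\int_{[0,1]^{d-|\mathfrak u|}}\varphi(\boldsymbol z)\,\mathrm d\boldsymbol z_{\{1,\dots,d\}\setminus\mathfrak u}$. Then $V_{\mathrm{GHK}}(\varphi)=\left(\left|\int_{[0,1]^d}\varphi\,\mathrm d\boldsymbol z\right|^2+\sum_{\emptyset\ne\mathfrak u\subseteq\{1,\dots,d\}}\left(V^{(|\mathfrak u|)}(\varphi_{\mathfrak u})\right)^2\right)^{1/2}$. Known fact defining the constants $C_{\epsilon,d}$: the equal-weight average of $\varphi$ over $M$ Sobol' points in dimension $d$ with Owen's scrambling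 has variance at most $(V_{\mathrm{GHK}}(\varphi))^2C_{\epsilon,d}^2M^{-3+2\epsilon}$ for any $\epsilon>0$, with $C_{\epsilon,d}\to\infty$ as $\epsilon\to0$. rDLQMC estimator. Let $\boldsymbol u^{(1)},\dots,\boldsymbol u^{(N)}\in[0,1]^{d_1}$ and $\boldsymbol t^{(1)},\dots,\boldsymbol t^{(M)}\in[0,1]^{d_2}$ be Sobol' points, and let $\boldsymbol\rho,\boldsymbol\rho^{(1)},\dots,\boldsymbol\rho^{(N)}$ be independent randomizations by Owen's scrambling (random nested permutation of base 2 digits, the same for all points of a given sequence). With $\boldsymbol y^{(n)}=\boldsymbol\rho(\boldsymbol u^{(n)})$, $\boldsymbol x^{(n,m)}=\boldsymbol\rho^{(n)}(\boldsymbol t^{(m)})$, $I_{\mathrm{rDLQ}}=\frac1N\sum_{n=1}^Nf\left(\frac1M\sum_{m=1}^Mg_h(\boldsymbol y^{(n)},\boldsymbol x^{(n,m)})\right)$. Its computational work is $\mathcal O(NMh^{-\gamma})$. Optimized estimator. The error criterion is $|\mathbb E[I_{\mathrm{rDLQ}}]-I|\le(1-\kappa)TOL$ and $C_\alpha\sqrt{\mathbb V[I_{\mathrm{rDLQ}}]}\le\kappa\,TOL$ with $\kappa\in(0,1)$, $\alpha\in(0,1)$ fixed, $C_\alpha=1/\sqrt\alpha$. Neglecting higher-order terms, bias and variance are bounded by $C_{\mathrm{disc}}h^\eta+C^{(3)}_{\mathrm Q,\epsilon}M^{-(3-2\epsilon)}$ and $C^{(1)}_{\mathrm Q,\epsilon}N^{-(3-2\epsilon)}+C^{(2)}_{\mathrm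 Q,\epsilon}N^{-1}M^{-(3-2\epsilon)}$, respectively, with constants $C^{(1)}_{\mathrm Q,\epsilon}=2(V_{\mathrm{GHK}}(f(\bar g)))^2C_{\epsilon,d_1}^2$, $C^{(2)}_{\mathrm Q,\epsilon}=2\mathbb E[|\bar g|^2|f'(\bar g)|^2]k^2C_{\epsilon,d_2}^2$, $C^{(3)}_{\mathrm Q,\epsilon}=\frac12\mathbb E[|\bar g|^2|f''(\bar g)|]k^2C_{\epsilon,d_2}^2$ (treated as independent of $N,M,h,TOL$). The optimized estimator uses $(N^*,M^*,h^*,\kappa^* )$ solving $$\min_{(N,M,h,\kappa)}NMh^{-\gamma}\quad\text{subject to}\quad\frac{C^{(1)}_{\mathrm Q,\epsilon}}{N^{3-2\epsilon}}+\frac{C^{(2)}_{\mathrm Q,\epsilon}}{NM^{3-2\epsilon}}\le\left(\frac{\kappa\,TOL}{C_\alpha}\right)^2,\qquad C_{\mathrm{disc}}h^\eta+\frac{C^{(3)}_{\mathrm Q,\epsilon}}{M^{3-2\epsilon}}\le(1-\kappa)TOL,$$ and $W^*_{\mathrm{rDLQ}}$ is its work, i.e. the minimal value of $NMh^{-\gamma}$ up to a multiplicative constant. *)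

(* Defs.v *)
From HB Require Import structures.
From mathcomp Require Import all_boot all_order all_algebra qfpoly.
From mathcomp Require Import all_classical all_reals all_analysis.

Set Implicit Arguments.
Unset Strict Implicit.
Unset Printing Implicit Defensive.

Import Order.TTheory GRing.Theory Num.Theory.
Import numFieldNormedType.Exports.

Local Open Scope classical_set_scope.
Local Open Scope ring_scope.

Section Cube.
Variable R : realType.

Definition cube d : set (d.-tuple R) :=
  [set z | forall i, 0 <= tnth z i <= 1].

Definition open_cube d : set (d.-tuple R) :=
  [set z | forall i, 0 < tnth z i < 1].

Section CubeMeasureStep.
Variables (d : nat) (P : probability (d.-tuple R) R).

Let tcons (x : measurableTypeR R * d.-tuple R) : d.+1.-tuple R :=
  [tuple of x.1 :: x.2].

Let measurable_tcons : measurable_fun [set: _] tcons.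
Proof. exact: measurable_cons. Qed.

HB.instance Definition _ := isMeasurableFun.Build _ _ _ _ tcons measurable_tcons.

Definition cube_measure_step : probability (d.+1.-tuple R) R :=
  distribution ((uniform_prob (@ltr01 R) \x P)%E : probability _ _) tcons.

End CubeMeasureStep.

(* Lebesgue measure on [0,1]^d, carried by the d-tuples of reals: the d-fold
   product of the uniform probability on [0,1]. *)
Fixpoint cube_measure d : probability (d.-tuple R) R :=
  if d is d'.+1 then cube_measure_step (cube_measure d')
  else \d_ [tuple].

End Cube.

Arguments cube {R} d.
Arguments open_cube {R} d.
Arguments cube_measure {R} d.

Section MixedDerivatives.
Variables (R : realType) (d : nat).
Implicit Types (phi psi : d.-tuple R -> R) (z : d.-tuple R) (u : {set 'I_d}).

Definition set_coord z (i : 'I_d) (t : R) : d.-tuple R :=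
  [tuple if j == i then t else tnth z j | j < d].

Definition partial (i : 'I_d) phi z : R :=
  derive1 (fun t => phi (set_coord z i t)) (tnth z i).

(* For s = [:: i_1; ...; i_k], the iterated partial derivative
   d/dz_(i_1) ... d/dz_(i_k) phi; an index may be repeated. *)
Definition mixed (s : seq 'I_d) phi : d.-tuple R -> R := foldr partial phi s.

(* Derivatives are total functions in the library, so that existence has to be
   required separately. *)
Fixpoint has_mixed (s : seq 'I_d) phi : Prop :=
  if s is i :: s' then
    has_mixed s' phi /\
    forall z, open_cube d z ->
      derivable (fun t => mixed s' phi (set_coord z i t)) (tnth z i) 1
  else True.

(* phi_u, as a function on the whole cube that depends on the coordinates in u
   only; the dummy coordinates w_i with i in u integrate to 1. *)
Definition marginal u phi z : R :=
  (\int[cube_measure d]_(w in cube d)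
     phi [tuple if i \in u then tnth z i else tnth w i | i < d])%R.

(* V^(|u|)(psi) for a function psi of the coordinates in u. *)
Definition mixed_variation u psi : \bar R :=
  if `[< has_mixed (enum u) psi >] then
    ((\int[cube_measure d]_(z in cube d) (`|mixed (enum u) psi z| ^+ 2)%:E)
       `^ 2^-1)%E
  else +oo%E.

Definition V_GHK phi : \bar R :=
  ((`| \int[cube_measure d]_(z in cube d) (phi z)%:E | ^+ 2
    + \sum_(u : {set 'I_d} | u != finset.set0)
        mixed_variation u (marginal u phi) ^+ 2) `^ 2^-1)%E.

End MixedDerivatives.

Section Sobolev.
Variables (R : realType) (d : nat).
Implicit Types (phi psi v : d.-tuple R -> R) (s : seq 'I_d).

(* Membership in L^p([0,1]^d) only constrains the values on the cube. *)
Definition Lp_cube (p : \bar R) phi : Prop :=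
  phi \_ (cube d) \in Lfun (cube_measure d) p.

Definition test_function psi : Prop :=
  (forall s, has_mixed s psi /\
     continuous (fun x : 'rV[R]_d => mixed s psi [tuple x ord0 i | i < d])) /\
  (exists2 delta : R, 0 < delta & forall z,
     psi z != 0 -> forall i, delta <= tnth z i <= 1 - delta).

Definition weak_derivative s phi v : Prop :=
  forall psi, test_function psi ->
    (\int[cube_measure d]_(z in cube d) (phi z * mixed s psi z) =
     (-1) ^+ size s * \int[cube_measure d]_(z in cube d) (v z * psi z))%R.

(* W^{m,p}([0,1]^d); the sequence s lists a multi-index with multiplicity. *)
Definition sobolev_space (m : nat) (p : \bar R) phi : Prop :=
  Lp_cube p phi /\
  forall s, (size s <= m)%N -> exists2 v, Lp_cube p v & weak_derivative s phi v.

End Sobolev.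

(* V j l k is the k-th binary digit (of weight 2^-(k+1)) of the l-th direction
   number of coordinate j, all indices starting from 0.  The first coordinate is
   the van der Corput sequence.  Coordinate j > 0 is attached to a primitive
   polynomial X^s + a_1 X^(s-1) + ... + a_s over F_2 (with a_s = 1), and its
   direction numbers satisfy
     v_l = a_1 v_(l-1) + ... + a_s v_(l-s) + 2^-s v_(l-s)   (digitwise mod 2)
   for l >= s, the first s of them being free (with v_l / 2^-(l+1) odd). *)
Definition sobol_directions (V : nat -> nat -> nat -> bool) : Prop :=
  (forall l k, V 0%N l k = (l == k)) /\
  exists P : nat -> {poly 'F_2},
    (forall i j, (0 < i)%N -> (0 < j)%N -> P i = P j -> i = j) /\
    forall j, (0 < j)%N ->
      let s := (size (P j)).-1 in
      [/\ primitive_poly (P j),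
          forall l, V j l l,
          forall l k, (l < k)%N -> V j l k = false &
          forall l k, (s <= l)%N ->
            V j l k =
              \big[addb/false]_(1 <= i < s.+1)
                 (((P j)`_(s - i) != 0) && V j (l - i)%N k)
              (+) ((s <= k)%N && V j (l - s)%N (k - s)%N)].

(* k-th binary digit of the j-th coordinate of the n-th Sobol' point (n >= 0). *)
Definition sobol_digit (V : nat -> nat -> nat -> bool) (n j k : nat) : bool :=
  \big[addb/false]_(l < n) (odd (n %/ 2 ^ l) && V j l k).

Section Owen.
Variable R : realType.

(* The random nested permutation applied to the k-th digit of coordinate j is
   the transposition of {0,1} when the bit attached to j and to the preceding
   digits is true, and the identity otherwise. *)
Definition owen_coord (a : nat -> bool) (flip : seq bool -> bool) : R :=
  limn (series (fun k : nat =>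
    (a k (+) flip (mkseq a k))%:R / 2 ^+ k.+1 : R)).

Definition scrambled_sobol V (d n : nat) (flip : nat -> seq bool -> bool) :
    d.-tuple R :=
  [tuple owen_coord (sobol_digit V n j) (flip j) | j < d].

(* Independent uniform bits: every finite subfamily is uniformly distributed. *)
Definition fair_bits dO (Omega : measurableType dO) (P : probability Omega R)
    (I : eqType) (xi : I -> Omega -> bool) : Prop :=
  (forall i, measurable [set w | xi i w]) /\
  forall (s : seq I) (b : I -> bool), uniq s ->
    P [set w | all (fun i => xi i w == b i) s] = (2^-1 ^+ size s)%:E.

Definition sobol_mean V (d M : nat) (phi : d.-tuple R -> R)
    (flip : nat -> seq bool -> bool) : R :=
  M%:R^-1 * \sum_(n < M) phi (scrambled_sobol V d n flip).

(* c is an admissible value of C_{eps,d}.  The number of points is a power of 2: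
   an equal-weight mean cannot have variance o(M^-2) along all integers M, since
   M and M+1 points differ by a single term of fixed variance. *)
Definition owen_variance_bound V dO (Omega : measurableType dO)
    (P : probability Omega R) (flip : nat -> seq bool -> Omega -> bool)
    (d : nat) (eps c : R) : Prop :=
  forall phi : d.-tuple R -> R,
    measurable_fun (cube d) phi -> (V_GHK phi < +oo)%E ->
    forall m : nat, let M := (2 ^ m)%N in
    ('V_P[fun w => sobol_mean V M phi (fun j q => flip j q w)] <=
     V_GHK phi ^+ 2 * (c ^+ 2 * M%:R `^ (- 3 + 2 * eps))%:E)%E.

End Owen.

Section Estimator.
Variables (R : realType) (d1 d2 : nat) (V : nat -> nat -> nat -> bool).
(* One realization of the bits of all the scramblings: index 0 is the scrambling
   rho of the outer points, index n.+1 the one of the n-th inner sample. *)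
Variable flip : nat -> nat -> seq bool -> bool.

Definition outer_point (n : nat) : d1.-tuple R :=
  scrambled_sobol R V d1 n (flip 0%N).

Definition inner_point (n m : nat) : d2.-tuple R :=
  scrambled_sobol R V d2 m (flip n.+1).

Definition rDLQ_estimate (f : R -> R) (g : d1.-tuple R -> d2.-tuple R -> R)
    (N M : nat) : R :=
  N%:R^-1 * \sum_(n < N)
    f (M%:R^-1 * \sum_(m < M) g (outer_point n) (inner_point n m)).

(* Total cost of the evaluations of g made by the estimator above. *)
Definition rDLQ_work (cost : d1.-tuple R -> d2.-tuple R -> R) (N M : nat) : R :=
  \sum_(n < N) \sum_(m < M) cost (outer_point n) (inner_point n m).

End Estimator.

Section Moments.
Variables (R : realType) (d1 d2 : nat).
Implicit Types (f : R -> R) (g : d1.-tuple R -> d2.-tuple R -> R).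

Definition inner_integral g (y : d1.-tuple R) : R :=
  (\int[cube_measure d2]_(x in cube d2) g y x)%R.

Definition outer_integral f g : \bar R :=
  (\int[cube_measure d1]_(y in cube d1) (f (inner_integral g y))%:E)%E.

(* E[|gbar|^2 |f'(gbar)|^2] *)
Definition moment_df f g : \bar R :=
  (\int[cube_measure d1]_(y in cube d1)
     (`|inner_integral g y| ^+ 2 * `|derive1 f (inner_integral g y)| ^+ 2)%:E)%E.

(* E[|gbar|^2 |f''(gbar)|] *)
Definition moment_ddf f g : \bar R :=
  (\int[cube_measure d1]_(y in cube d1)
     (`|inner_integral g y| ^+ 2 * `|derive1n 2 f (inner_integral g y)|)%:E)%E.

(* Least bound, uniform in the discretization parameter, of a quantity attached
   to the discretized integrand g_h; it does not depend on h. *)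
Definition uniform_sup (h0 : R) (F : R -> \bar R) : \bar R :=
  ereal_sup [set F h | h in [set h | 0 < h <= h0]].

End Moments.

Section Program.
Variable R : realType.

Record program := Program {
  prog_rate : R;      (* 3 - 2 eps *)
  prog_C1 : R; prog_C2 : R; prog_C3 : R;
  prog_Cdisc : R; prog_eta : R; prog_gamma : R; prog_Calpha : R }.

Implicit Types (p : program) (TOL h kappa : R) (N M : nat).

Definition objective p N M h : R := N%:R * M%:R * h `^ (- prog_gamma p).

Definition feasible p TOL N M h kappa : Prop :=
  [/\ (0 < N)%N, (0 < M)%N, 0 < h, 0 < kappa < 1 &
      prog_C1 p / N%:R `^ prog_rate p + prog_C2 p / (N%:R * M%:R `^ prog_rate p)
        <= (kappa * TOL / prog_Calpha p) ^+ 2 /\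
      prog_Cdisc p * h `^ prog_eta p + prog_C3 p / M%:R `^ prog_rate p
        <= (1 - kappa) * TOL].

Definition optimal p TOL N M h kappa : Prop :=
  feasible p TOL N M h kappa /\
  forall N' M' h' kappa', feasible p TOL N' M' h' kappa' ->
    objective p N M h <= objective p N' M' h'.

(* Infimum of the program, +oo when it is infeasible; it is the minimum
   whenever an optimal point exists. *)
Definition optimal_value p TOL : \bar R :=
  ereal_inf [set r | exists N M h kappa,
    feasible p TOL N M h kappa /\ r = (objective p N M h)%:E].

End Program.

(* The program defining the optimized estimator.  The constants are those of the
   bias and variance bounds, with the moments of gbar_h taken in their least
   bound over 0 < h <= h0, so that they do not depend on N, M, h and TOL. *)
Definition rDLQ_program (R : realType) (d1 d2 : nat) (f : R -> R)
    (gh : R -> d1.-tuple R -> d2.-tuple R -> R) (C : R -> nat -> R)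
    (h0 k Cd et ga alpha eps : R) : program R :=
  {| prog_rate := 3 - 2 * eps;
     prog_C1 := 2 * fine (uniform_sup h0
              (fun h => V_GHK (f \o inner_integral (gh h)))) ^+ 2
            * C eps d1 ^+ 2;
     prog_C2 := 2 * fine (uniform_sup h0 (fun h => moment_df f (gh h)))
            * k ^+ 2 * C eps d2 ^+ 2;
     prog_C3 := 2^-1 * fine (uniform_sup h0 (fun h => moment_ddf f (gh h)))
            * k ^+ 2 * C eps d2 ^+ 2;
     prog_Cdisc := Cd; prog_eta := et; prog_gamma := ga;
     prog_Calpha := (Num.sqrt alpha)^-1 |}.

Definition work_exponent (R : realType) (eps et ga : R) : R :=
  2 / (3 - 2 * eps) + (4 - 4 * eps) / (3 - 2 * eps) ^+ 2 + ga / et.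

Definition monotonic (R : realType) (F : R -> R) : Prop :=
  {homo F : x y / x <= y} \/ {homo F : x y /~ x <= y}.

(* Main.v *)
Require Import Defs.
From HB Require Import structures.
From mathcomp Require Import all_boot all_order all_algebra ring lra.
From mathcomp Require Import all_classical all_reals all_analysis.

Set Implicit Arguments.
Unset Strict Implicit.
Unset Printing Implicit Defensive.

Import Order.TTheory GRing.Theory Num.Theory.
Import numFieldNormedType.Exports.

Local Open Scope classical_set_scope.
Local Open Scope ring_scope.

(** Write T for the tolerance, r = 3 - 2 eps >= 2 for the rate, and eliminate the
    three unknowns one after the other.  The variance constraint forces N to be
    of order at least T^(-2/r); with N of exactly this order, its second term
    asks for M^r of order T^(-2) / N = T^(-2 + 2/r), that is, M of order T^(-s)
    with s = 2 (r - 1) / r^2 = (4 - 4 eps) / (3 - 2 eps)^2; the bias constraint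
    asks for h of order T^(1/eta).  The remaining condition M^r >= c / T of the
    bias constraint is then implied, because 2 - 2/r >= 1 as soon as r >= 2; this
    is why eps < 1/2 is what sufficiently small means.  Multiplying the three
    orders gives the exponent of the theorem.

    The upper bound is [near_optimal_point]: with kappa = 1/2, rounding up N and
    M costs a factor 2 each.  The work of an actual run is bounded by the
    objective times a constant, since all scrambled points stay in the cube
    ([scrambled_sobol_cube]) and an optimal h falls below h0 for small T
    ([feasible_mesh_lt]).

    The matching lower bound is [objective_ge].  With B = (T / C_alpha)^2 the
    variance constraint gives C1 <= B N^r and C2 <= B N M^r; raising these to the
    powers (r - 1) / r^2 and 1 / r and multiplying yields exactly N M on the
    right-hand side.  The resulting constant contains C1 and C2 to positive
    powers, hence diverges with the scrambling constants as eps -> 0, and no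
    admissible constant can stay below it ([rDLQ_lower_constant_cvg]). *)

(** * Real powers and rounding *)

Section Powers.
Variable R : realType.
Implicit Types x y r s : R.

Lemma powRDpos x r s : 0 < x -> x `^ (r + s) = x `^ r * x `^ s.
Proof. by move=> x0; apply/powRD/implyP => _; rewrite gt_eqF. Qed.

Lemma ler_powR2r r x y : 0 <= r -> 0 <= x -> x <= y -> x `^ r <= y `^ r.
Proof.
move=> r0 x0 xy; apply: ge0_ler_powR => //; rewrite nnegrE//.
exact: le_trans xy.
Qed.

Lemma exists_nat_between x : 1 <= x -> exists n : nat, x <= n%:R <= 2 * x.
Proof.
move=> x1; have x0 : 0 <= x by lra.
exists (Num.truncn x).+1; have /andP[lo hi] := truncn_itv x0.
by rewrite (ltW hi)/= -natr1; lra.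
Qed.

End Powers.

(** * Sharp order of the optimal value *)

Section Program.
Variable R : realType.
Implicit Types (p : program R) (TOL h kappa : R) (N M : nat).

(** The s for which M of order T^(-s) meets the second variance term, once N has
    order T^(-2/r). *)
Definition sample_exponent p : R :=
  2 * (prog_rate p - 1) / prog_rate p ^+ 2.

Definition program_exponent p : R :=
  2 / prog_rate p + sample_exponent p + prog_gamma p / prog_eta p.

Definition well_posed p : Prop :=
  [/\ 2 <= prog_rate p, [/\ 0 <= prog_C1 p, 0 <= prog_C2 p & 0 <= prog_C3 p],
      0 < prog_Cdisc p, 0 < prog_eta p /\ 0 < prog_gamma p & 0 < prog_Calpha p].

(** The leading factors of N and M at the near-optimal point.  Being at least 1,
    they satisfy a <= a^r, so that no r-th root of the constants has to be taken;
    the factors 8 and 4 make each variance term at most an eighth of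
    (T / C_alpha)^2 and the inner-sample bias at most T / 4. *)
Definition outer_scale p : R := 1 + 8 * prog_C1 p * prog_Calpha p ^+ 2.

Definition inner_scale p : R :=
  1 + 8 * prog_C2 p * prog_Calpha p ^+ 2 + 4 * prog_C3 p.

(** The objective at the near-optimal point, up to the power of T; the 4 in front
    pays for rounding up N and M. *)
Definition upper_constant p : R :=
  4 * outer_scale p * inner_scale p *
  (4 * prog_Cdisc p) `^ (prog_gamma p / prog_eta p).

Lemma upper_constant_ge0 p : well_posed p -> 0 <= upper_constant p.
Proof.
move=> [r2 [C10 C20 C30] Cd0 [et0 ga0] Ca0].
have Ca2 : 0 <= prog_Calpha p ^+ 2 by rewrite sqr_ge0.
rewrite /upper_constant mulr_ge0 ?powR_ge0// mulr_ge0// ?mulr_ge0//.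
  by rewrite /outer_scale addr_ge0// mulr_ge0// mulr_ge0.
by rewrite /inner_scale !addr_ge0// mulr_ge0// mulr_ge0.
Qed.

(** All constraints are split evenly: kappa = 1/2, and the discretization and the
    inner sampling each get half of the bias budget T / 2.  The inner-sampling
    bias is of order T^(2 - 2/r), which is at most T because r >= 2 and T <= 1. *)
Lemma near_optimal_point p TOL : well_posed p -> 0 < TOL <= 1 ->
  exists N M h kappa, feasible p TOL N M h kappa /\
    objective p N M h <= upper_constant p * TOL `^ (- program_exponent p).
Proof.
case: p => r C1 C2 C3 Cd et ga Ca [/= r2 [C10 C20 C30] Cd0 [et0 ga0] Ca0].
move=> /andP[T0 T1].
rewrite /upper_constant /program_exponent /sample_exponent /outer_scale
  /inner_scale /feasible /objective /=.
have Ca2 : 0 < Ca ^+ 2 by rewrite exprn_gt0.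
set a : R := 1 + _; set c : R := 1 + _ + _; set s := 2 * (r - 1) / r ^+ 2.
have r0 : 0 < r by lra.
have s0 : 0 <= s by rewrite /s divr_ge0 ?sqr_ge0//; lra.
have sr : s * r = 2 - 2 / r by rewrite /s; field; lra.
have ir : r^-1 <= 2^-1 by rewrite lef_pV2 ?posrE//.
have sr1 : 1 <= s * r by rewrite sr; lra.
have P1 : 0 <= C1 * Ca ^+ 2 by rewrite mulr_ge0// ltW.
have P2 : 0 <= C2 * Ca ^+ 2 by rewrite mulr_ge0// ltW.
have a1 : 1 <= a by rewrite /a -mulrA; lra.
have c1 : 1 <= c by rewrite /c -mulrA; lra.
have T01 : 0 < TOL <= 1 by rewrite T0.
have pow_ge1 e : 0 <= e -> 1 <= TOL `^ (- e).
  by move=> e0; rewrite -[leLHS](powRr0 TOL) ger_powR// oppr_le0.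
have scaled_ge1 x e : 1 <= x -> 0 <= e -> 1 <= x * TOL `^ (- e).
  move=> x1 e0; apply: le_trans (pow_ge1 e e0) _.
  by rewrite ler_peMl// powR_ge0.
have twor0 : 0 <= 2 / r by rewrite divr_ge0// ltW.
have [N /andP[Nlo Nhi]] := exists_nat_between (scaled_ge1 _ _ a1 twor0).
have [M /andP[Mlo Mhi]] := exists_nat_between (scaled_ge1 _ _ c1 s0).
have N1 : 1 <= N%:R :> R := le_trans (scaled_ge1 _ _ a1 twor0) Nlo.
have M1 : 1 <= M%:R :> R := le_trans (scaled_ge1 _ _ c1 s0) Mlo.
have Td0 : 0 < TOL / (4 * Cd) by rewrite divr_gt0// mulr_gt0.
have scaled_powr x e n : 1 <= x -> x * TOL `^ (- e) <= n%:R ->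
    x * TOL `^ (- (e * r)) <= n%:R `^ r.
  move=> x1 xn; apply: (@le_trans _ _ ((x * TOL `^ (- e)) `^ r)); last first.
    by apply: ler_powR2r => //; [lra | rewrite mulr_ge0 ?powR_ge0//; lra].
  rewrite powRM ?powR_ge0//; last by lra.
  rewrite -powRrM -mulNr ler_wpM2r ?powR_ge0//.
  by apply: le1r_powR => //; lra.
have Nr : a * TOL ^- 2 <= N%:R `^ r.
  have := scaled_powr _ _ _ a1 Nlo.
  (* a numeral of the form n%:R lets the real power become a natural one *)
  rewrite (_ : 2 / r * r = 2%:R); last by field; lra.
  by rewrite powRN powR_mulrn// ltW.
have Mr := scaled_powr _ _ _ c1 Mlo.
have NMr : c * TOL ^- 2 <= N%:R * M%:R `^ r.
  have -> : TOL ^- 2 = TOL `^ (- (2 / r)) * TOL `^ (- (s * r)).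
    rewrite -powRDpos// -opprD sr (_ : 2 / r + _ = 2%:R); last by ring.
    by rewrite powRN powR_mulrn// ltW.
  rewrite mulrCA ler_pM ?powR_ge0// ?mulr_ge0 ?powR_ge0//; first by lra.
  apply: le_trans Nlo; rewrite ler_peMl// powR_ge0//.
have T2 : 0 < TOL ^+ 2 by rewrite exprn_gt0.
have share x y z : 0 <= x -> 0 < z -> 0 < y -> 8 * x * Ca ^+ 2 <= z ->
   z * TOL ^- 2 <= y -> x / y <= TOL ^+ 2 / (8 * Ca ^+ 2).
  move=> x0 z0 y0 xz zy.
  rewrite ler_pdivrMr// mulrAC ler_pdivlMr ?mulr_gt0//.
  rewrite ler_pdivrMr// in zy.
  by apply: le_trans (_ : z <= _); [lra | rewrite mulrC].
have N0 : 0 < N%:R :> R := lt_le_trans ltr01 N1.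
have M0 : 0 < M%:R :> R := lt_le_trans ltr01 M1.
have Nr0 : 0 < N%:R `^ r :> R := powR_gt0 _ N0.
have Mr0 : 0 < M%:R `^ r :> R := powR_gt0 _ M0.
have a0 : 0 < a := lt_le_trans ltr01 a1.
have c0 : 0 < c := lt_le_trans ltr01 c1.
have C1a : 8 * C1 * Ca ^+ 2 <= a by rewrite lerDr.
have C2c : 8 * C2 * Ca ^+ 2 <= c.
  by rewrite /c addrAC lerDr addr_ge0// mulr_ge0.
have C3c : 4 * C3 <= c by rewrite lerDr addr_ge0// -mulrA mulr_ge0.
have var1 := share _ _ _ C10 a0 Nr0 C1a Nr.
have var2 := share _ _ _ C20 c0 (mulr_gt0 N0 Mr0) C2c NMr.
exists N, M, ((TOL / (4 * Cd)) `^ et^-1), 2^-1; split.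
  split; [by rewrite -(ltr_nat R)|by rewrite -(ltr_nat R)|exact: powR_gt0| |].
    by rewrite invr_gt0 ltr0n invf_lt1 ?ltr1n.
  split.
    apply: le_trans (lerD var1 var2) _.
    rewrite le_eqVlt; apply/orP; left; apply/eqP.
    by field; rewrite gt_eqF.
  rewrite -powRrM mulVf ?gt_eqF// powRr1 ?(ltW Td0)//.
  have -> : Cd * (TOL / (4 * Cd)) = TOL / 4 by field; rewrite gt_eqF.
  have -> : (1 - 2^-1) * TOL = TOL / 4 + TOL / 4 by field.
  rewrite lerD2l.
  rewrite ler_pdivrMr//.
  have : c * TOL `^ (-1) <= M%:R `^ r.
    by apply: le_trans Mr; rewrite ler_wpM2l ?(ltW c0)// ger_powR// lerN2.
  rewrite powR_inv1 ?(ltW T0)// ler_pdivrMr// => cM.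
  rewrite mulrAC ler_pdivlMr// mulrC [leRHS]mulrC.
  exact: le_trans cM.
rewrite -powRrM.
have -> : (TOL / (4 * Cd)) `^ (et^-1 * - ga) =
    (4 * Cd) `^ (ga / et) * TOL `^ (- (ga / et)).
  rewrite powRM ?invr_ge0 ?ltW// ?mulr_gt0// mulrC; congr (_ * _); last first.
    by congr (_ `^ _); ring.
  rewrite -powR_inv1 ?ltW ?mulr_gt0// -powRrM; congr (_ `^ _); ring.
rewrite !opprD !powRDpos//.
set X := _ `^ (- (2 / r)) in Nhi *; set Y := _ `^ (- s) in Mhi *.
set Z := TOL `^ _; set D := _ `^ (ga / et).
have -> : 4 * a * c * D * (X * Y * Z) =
  (2 * (a * X)) * (2 * (c * Y)) * (D * Z) by ring.
rewrite ler_wpM2r ?mulr_ge0 ?powR_ge0// ler_pM//.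
Qed.

(** The constant of the lower bound; the exponents of C1 and C2 are those for
    which the powers of N and M in the variance constraint combine into N M. *)
Definition lower_constant p : R :=
  prog_C1 p `^ ((prog_rate p - 1) / prog_rate p ^+ 2) *
  prog_C2 p `^ (prog_rate p)^-1 *
  prog_Calpha p `^ (2 / prog_rate p + sample_exponent p) *
  prog_Cdisc p `^ (prog_gamma p / prog_eta p).

Lemma feasible_mesh_le p TOL N M h kappa :
  well_posed p -> 0 < TOL -> feasible p TOL N M h kappa ->
  prog_Cdisc p * h `^ prog_eta p <= TOL.
Proof.
case: p => r C1 C2 C3 Cd et ga Ca [/= r2 [C10 C20 C30] Cd0 [et0 ga0] Ca0] T0.
case=> /= N0 M0 h_gt0 /andP[k0 k1] [_ bias].
apply: (@le_trans _ _ ((1 - kappa) * TOL)).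
  by apply: le_trans bias; rewrite lerDl divr_ge0// powR_ge0.
by rewrite ler_piMl ?(ltW T0)//; lra.
Qed.

(** The order of the near-optimal point cannot be improved: a weighted geometric
    mean of the two variance bounds controls N M, and the bias bound controls
    h^(- gamma) from below. *)
Lemma objective_ge p TOL N M h kappa :
  well_posed p -> 0 < TOL -> feasible p TOL N M h kappa ->
  lower_constant p * TOL `^ (- program_exponent p) <= objective p N M h.
Proof.
move=> wp T0 feas; have := feasible_mesh_le wp T0 feas.
case: p wp feas => r C1 C2 C3 Cd et ga Ca.
case=> [/= r2 [C10 C20 C30] Cd0 [et0 ga0] Ca0].
case=> /= N0 M0 h_gt0 /andP[k0 k1] [var _] mesh.
rewrite /lower_constant /program_exponent /sample_exponent /objective /=.
have r0 : 0 < r by lra.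
have nN0 : 0 < N%:R :> R by rewrite ltr0n.
have nM0 : 0 < M%:R :> R by rewrite ltr0n.
have Nr0 : 0 < N%:R `^ r :> R by apply: powR_gt0.
have Mr0 : 0 < M%:R `^ r :> R by apply: powR_gt0.
have [[T0w Cd0w] Ca0w] := (ltW T0, ltW Cd0, ltW Ca0).
have [[N0w M0w] r0w] := (ltW nN0, ltW nM0, ltW r0).
(* B is kept opaque, so that its square is not read as a product of quotients *)
have [B Bdef] : exists B, B = (TOL / Ca) ^+ 2 by eexists.
have TCa0 : 0 < TOL / Ca by rewrite divr_gt0.
have B0 : 0 < B by rewrite Bdef exprn_gt0.
have [TCa0w B0w] := (ltW TCa0, ltW B0).
have var' : C1 / N%:R `^ r + C2 / (N%:R * M%:R `^ r) <= B.
  apply: le_trans var _; rewrite Bdef -mulrA exprMn ler_piMl ?sqr_ge0//.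
  by rewrite expr_le1// ltW.
have t1 : 0 <= C1 / N%:R `^ r by rewrite divr_ge0// ltW.
have t2 : 0 <= C2 / (N%:R * M%:R `^ r) by rewrite divr_ge0// mulr_ge0// ltW.
have {t2}b1 : C1 <= B * N%:R `^ r by rewrite -ler_pdivrMr//; lra.
have {t1}b2 : C2 <= B * (N%:R * M%:R `^ r).
  by rewrite -ler_pdivrMr ?mulr_gt0//; lra.
set e1 := (r - 1) / r ^+ 2.
have e10 : 0 <= e1 by rewrite divr_ge0 ?sqr_ge0//; lra.
(* the exponents of N add up to r e1 + 1/r = 1, that of M is r / r = 1 *)
have NM : C1 `^ e1 * C2 `^ r^-1 <= B `^ (e1 + r^-1) * (N%:R * M%:R).
  have ir0 : 0 <= r^-1 by rewrite invr_ge0 ltW.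
  apply: le_trans (ler_pM (powR_ge0 _ _) (powR_ge0 _ _)
    (ler_powR2r e10 C10 b1) (ler_powR2r ir0 C20 b2)) _.
  rewrite !powRM ?mulr_ge0 ?powR_ge0// -!powRrM powRDpos//.
  rewrite mulfV ?gt_eqF// powRr1//.
  rewrite le_eqVlt; apply/orP; left; apply/eqP.
  rewrite [LHS]mulrACA; congr (_ * _).
  rewrite mulrA -powRDpos// (_ : r * e1 + r^-1 = 1) ?powRr1//.
  by rewrite /e1; field; lra.
(* the bias bound raised to the power gamma / eta and inverted *)
have mesh' : Cd `^ (ga / et) * TOL `^ (- (ga / et)) <= h `^ (- ga).
  have := ler_powR2r (divr_ge0 (ltW ga0) (ltW et0))
    (mulr_ge0 (ltW Cd0) (powR_ge0 _ _)) mesh.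
  rewrite powRM ?powR_ge0// -powRrM.
  rewrite (_ : et * (ga / et) = ga); last by field; lra.
  rewrite !powRN => CdT.
  rewrite ler_pdivrMr ?powR_gt0// [leRHS]mulrC ler_pdivlMr ?powR_gt0//.
set E := 2 / r + _.
have BE : B `^ (e1 + r^-1) = TOL `^ E / Ca `^ E.
  rewrite Bdef -powR_mulrn// -powRrM powRM ?invr_ge0//.
  rewrite (_ : 2%:R * (e1 + r^-1) = E); last by rewrite /E /e1; field; lra.
  by rewrite -powR_inv1// -!powRrM mulN1r powRN.
have NM' : C1 `^ e1 * C2 `^ r^-1 * Ca `^ E * TOL `^ (- E) <= N%:R * M%:R.
  rewrite powRN ler_pdivrMr ?powR_gt0//.
  move: NM; rewrite BE mulrAC ler_pdivlMr ?powR_gt0//.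
  by rewrite [leRHS]mulrC.
rewrite opprD [TOL `^ (- E - _)]powRDpos//.
set D := Cd `^ _ in mesh' *; set Z := TOL `^ (- (ga / et)) in mesh' *.
rewrite mulrACA; apply: (ler_pM _ _ NM' mesh'); rewrite ?mulr_ge0 ?powR_ge0//.
Qed.

End Program.

Section OptimalValue.
Variable R : realType.
Implicit Types (p : program R) (TOL h kappa : R) (N M : nat).

Lemma optimal_value_le p TOL : well_posed p -> 0 < TOL <= 1 ->
  (optimal_value p TOL <=
   (upper_constant p * TOL `^ (- program_exponent p))%:E)%E.
Proof.
move=> wp /(near_optimal_point wp)[N [M [h [kappa [feas obj]]]]].
apply: (@le_trans _ _ (objective p N M h)%:E); last by rewrite lee_fin.
by apply: ereal_inf_lbound; exists N, M, h, kappa.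
Qed.

Lemma optimal_objective_le p TOL N M h kappa : well_posed p -> 0 < TOL <= 1 ->
  optimal p TOL N M h kappa ->
  objective p N M h <= upper_constant p * TOL `^ (- program_exponent p).
Proof.
move=> wp T01 [_ opt].
have [N' [M' [h' [kappa' [feas obj]]]]] := near_optimal_point wp T01.
exact: le_trans (opt _ _ _ _ feas) obj.
Qed.

Lemma optimal_value_ge p TOL : well_posed p -> 0 < TOL ->
  ((lower_constant p * TOL `^ (- program_exponent p))%:E <=
   optimal_value p TOL)%E.
Proof.
move=> wp T0; apply/ereal_infP => _ [N [M [h [kappa [feas ->]]]]].
by rewrite lee_fin; apply: objective_ge feas.
Qed.

(** The program itself does not restrict h to the range (0, h0] where the cost
    model is valid; small tolerances do. *)
Lemma feasible_mesh_lt p TOL N M h kappa h0 : well_posed p -> 0 < h0 ->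
  0 < TOL -> TOL < prog_Cdisc p * h0 `^ prog_eta p ->
  feasible p TOL N M h kappa -> h < h0.
Proof.
move=> wp h00 T0 Tlt feas; have mesh := feasible_mesh_le wp T0 feas.
case: wp => _ _ Cd0 [et0 _] _; rewrite ltNge; apply/negP => h0h.
have := le_lt_trans mesh Tlt.
by rewrite ltr_pM2l// ltNge ler_powR2r// ltW.
Qed.

(** For r between 2 and 3 the exponents in the lower constant vary with eps; this
    bound by a fixed power of C2 makes its divergence visible. *)
Lemma lower_constant_ge p : well_posed p -> prog_rate p <= 3 ->
  1 <= prog_C1 p -> 1 <= prog_C2 p -> 1 <= prog_Calpha p ->
  prog_C2 p `^ 3^-1 * prog_Cdisc p `^ (prog_gamma p / prog_eta p) <=
  lower_constant p.
Proof.
case: p => r C1 C2 C3 Cd et ga Ca [/= r2 _ _ _ _] r3 C11 C21 Ca1.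
rewrite /lower_constant /sample_exponent /= ler_wpM2r ?powR_ge0//.
have r0 : 0 < r by lra.
have r10 : 0 <= r - 1 by lra.
have pow_ge1 (x e : R) : 1 <= x -> 0 <= e -> 1 <= x `^ e.
  by move=> x1 e0; rewrite -[leLHS](powRr0 x) ler_powR.
have C1e : 1 <= C1 `^ ((r - 1) / r ^+ 2).
  by rewrite pow_ge1// divr_ge0// sqr_ge0.
have Cae : 1 <= Ca `^ (2 / r + 2 * (r - 1) / r ^+ 2).
  rewrite pow_ge1// addr_ge0// divr_ge0 ?sqr_ge0 ?(ltW r0)//.
  by rewrite mulr_ge0.
have C2e : C2 `^ 3^-1 <= C2 `^ r^-1.
  by rewrite ler_powR// lef_pV2// posrE.
apply: le_trans C2e _; rewrite -[leLHS]mul1r -[leLHS]mulr1.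
by rewrite !ler_pM ?mulr_ge0 ?powR_ge0.
Qed.

End OptimalValue.

(** * Scrambled points and the work of one run *)

Section Scrambling.
Variable R : realType.

(** The series of any binary digits is dominated by the geometric one; its
    convergence has to be established since a divergent limit would be
    unspecified. *)
Lemma owen_coord_unit (a : nat -> bool) (flip : seq bool -> bool) :
  0 <= owen_coord R a flip <= 1.
Proof.
set digit : R^nat := fun k =>
  (a k (+) flip (mkseq a k))%:R / 2 ^+ k.+1.
have digit_ge0 k : 0 <= digit k by rewrite divr_ge0// exprn_ge0.
have partial_sum n : series digit n <= 1 - 2^-1 ^+ n.
  elim: n => [|n IHn]; first by rewrite /series/= big_geq// expr0 subrr.
  rewrite seriesSr; apply: le_trans (lerD IHn (_ : _ <= 2^-1 ^+ n.+1)) _.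
    rewrite /digit exprVn ler_piMl ?invr_ge0 ?exprn_ge0//.
    by rewrite lern1 leq_b1.
  by rewrite exprS; lra.
have sum_le1 n : series digit n <= 1.
  by apply: le_trans (partial_sum n) _; rewrite gerBl exprn_ge0// invr_ge0.
have cvg_sum : cvgn (series digit).
  apply: nondecreasing_is_cvgn.
    by apply: nondecreasing_series => n _ _; exact: digit_ge0.
  by exists 1 => _ [n _ <-].
apply/andP; split.
  by apply: limr_ge => //; apply: nearW => n; exact: sumr_ge0.
by apply: limr_le => //; exact: nearW.
Qed.

Lemma scrambled_sobol_cube V d n flip : cube d (scrambled_sobol R V d n flip).
Proof. by move=> i; rewrite tnth_mktuple owen_coord_unit. Qed.

Lemma rDLQ_work_le d1 d2 V flip (cost : d1.-tuple R -> d2.-tuple R -> R)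
    (c : R) N M :
  (forall y x, cube d1 y -> cube d2 x -> cost y x <= c) ->
  rDLQ_work V flip cost N M <= N%:R * M%:R * c.
Proof.
move=> cost_le.
have constE n (x : R) : n%:R * x = \sum_(i < n) x.
  by rewrite sumr_const card_ord mulr_natl.
rewrite -mulrA !constE; apply: ler_sum => n _; apply: ler_sum => m _.
by apply: cost_le; exact: scrambled_sobol_cube.
Qed.

End Scrambling.

(** * The constants of the rDLQMC program *)

Section Constants.
Variable R : realType.

Lemma uniform_sup_ge0 (h0 : R) (F : R -> \bar R) :
  0 < h0 -> (forall h, (0 <= F h)%E) -> (0 <= uniform_sup h0 F)%E.
Proof.
move=> h00 F0; apply: le_trans (F0 h0) _; apply: ereal_sup_ubound.
by exists h0 => //=; rewrite h00 lexx.
Qed.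

Section RDLQ.
Variables (d1 d2 : nat) (f : R -> R) (gh : R -> d1.-tuple R -> d2.-tuple R -> R).
Variables (C : R -> nat -> R) (h0 k Cd et ga alpha : R).

Let prog eps := rDLQ_program f gh C h0 k Cd et ga alpha eps.

(** Nonnegativity of the constants comes from that of the moments, and it survives
    taking [fine] of an infinite supremum; eps < 1/2 is the condition r >= 2. *)
Lemma rDLQ_well_posed eps : 0 < h0 -> 0 < Cd -> 0 < et -> 0 < ga ->
  0 < alpha -> eps < 2^-1 -> well_posed (prog eps).
Proof.
move=> h00 Cd0 et0 ga0 alpha0 eps2.
have scaled_ge0 (x y u v : R) : 0 <= x -> 0 <= y -> 0 <= x * y * u ^+ 2 * v ^+ 2.
  by move=> x0 y0; rewrite mulr_ge0 ?sqr_ge0// mulr_ge0 ?sqr_ge0// mulr_ge0.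
split => //=.
- lra.
- split; first by rewrite mulr_ge0 ?sqr_ge0// mulr_ge0// sqr_ge0.
    apply: scaled_ge0 => //; apply: fine_ge0; apply: uniform_sup_ge0 => // h.
    by apply: integral_ge0 => y _; rewrite lee_fin mulr_ge0 ?sqr_ge0.
  apply: scaled_ge0; rewrite ?invr_ge0//.
  apply: fine_ge0; apply: uniform_sup_ge0 => // h.
  by apply: integral_ge0 => y _; rewrite lee_fin mulr_ge0 ?sqr_ge0.
- by rewrite invr_gt0 sqrtr_gt0.
Qed.

Lemma rDLQ_exponent eps : eps < 2^-1 ->
  program_exponent (prog eps) = work_exponent eps et ga.
Proof.
move=> eps2; rewrite /program_exponent /sample_exponent /work_exponent /=.
by congr (_ + _ / _ + _); ring.
Qed.

(** Near eps = 0 both scrambling constants exceed any bound, so that C1 >= 1 while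
    C2 exceeds the cube of any prescribed number. *)
Lemma rDLQ_lower_constant_cvg :
  0 < h0 -> 0 < Cd -> 0 < et -> 0 < ga -> 0 < alpha <= 1 ->
  (0 < uniform_sup h0 (fun h => V_GHK (f \o inner_integral (gh h))) < +oo)%E ->
  (0 < uniform_sup h0 (fun h => moment_df f (gh h)) < +oo)%E -> 0 < k ->
  C eps d1 @[eps --> 0^'+] --> +oo -> C eps d2 @[eps --> 0^'+] --> +oo ->
  lower_constant (prog eps) @[eps --> 0^'+] --> +oo.
Proof.
move=> h00 Cd0 et0 ga0 /andP[alpha0 alpha1] /fine_gt0 V0 /fine_gt0 df0 k0.
move=> /cvgryPge C1oo /cvgryPge C2oo; apply/cvgryPge => B.
set c1 : R := 2 * fine (uniform_sup h0
  (fun h => V_GHK (f \o inner_integral (gh h)))) ^+ 2.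
set c2 : R := 2 * fine (uniform_sup h0 (fun h => moment_df f (gh h))) * k ^+ 2.
have c10 : 0 < c1 by rewrite mulr_gt0// exprn_gt0.
have c20 : 0 < c2 by rewrite mulr_gt0 ?mulr_gt0// exprn_gt0.
set D := Cd `^ (ga / et); have D0 : 0 < D by exact: powR_gt0.
have growing (c x y : R) : 0 < c -> 1 <= x -> y / c <= x -> y <= c * x ^+ 2.
  move=> c0 x1; rewrite ler_pdivrMr// mulrC => /le_trans; apply.
  by rewrite ler_pM2l// expr2 ler_peMl//; exact: le_trans x1.
near=> eps.
have eps0 : 0 < eps by near: eps; exact: nbhs_right_gt.
have eps2 : eps < 2^-1 by near: eps; apply: nbhs_right_lt; rewrite invr_gt0.
have wp := rDLQ_well_posed h00 Cd0 et0 ga0 alpha0 eps2.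
have C11 : 1 <= prog_C1 (prog eps).
  apply: growing => //; near: eps; exact: C1oo.
have C2large y : y / c2 <= C eps d2 -> y <= prog_C2 (prog eps).
  by apply: growing => //; near: eps; exact: C2oo.
have C21 : 1 <= prog_C2 (prog eps) by apply: C2large; near: eps; exact: C2oo.
have C2B : (`|B| / D) `^ 3 <= prog_C2 (prog eps).
  by apply: C2large; near: eps; exact: C2oo.
have BD0 : 0 <= `|B| / D by rewrite divr_ge0// ltW.
apply: le_trans (lower_constant_ge wp _ C11 C21 _); last 2 first.
- by rewrite /=; lra.
- by rewrite /= invf_ge1 ?sqrtr_gt0// -[leRHS]sqrtr1 ler_wsqrtr.
rewrite -ler_pdivrMr//; apply: (@le_trans _ _ (`|B| / D)).
  by rewrite ler_pM2r ?invr_gt0// ler_norm.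
have := ler_powR2r (_ : 0 <= 3^-1) (powR_ge0 _ _) C2B.
by rewrite -powRrM mulfV// powRr1//; apply; rewrite invr_ge0.
Unshelve. all: by end_near.
Qed.

End RDLQ.
End Constants.

(** * Work of the optimized estimator *)

Theorem corollary1 (R : realType) (d1 d2 : nat)
  (f : R -> R)
  (g : d1.-tuple R -> d2.-tuple R -> R)
  (gh : R -> d1.-tuple R -> d2.-tuple R -> R)
  (cost : R -> d1.-tuple R -> d2.-tuple R -> R)
  (V : nat -> nat -> nat -> bool)
  (dO : measure_display) (Omega : measurableType dO) (P : probability Omega R)
  (xi : nat -> nat -> seq bool -> Omega -> bool)
  (C : R -> nat -> R)
  (h0 b : R) (A : 'I_d1 -> R) (Cdisc eta gamma Cwork k alpha : R)
  (deltaK deltaK' : R) (p q p' q' : \bar R)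
  (d1_gt0 : (0 < d1)%N) (d2_gt0 : (0 < d2)%N)
  (* outer function *)
  (f_nonlinear : ~ exists a, forall x, f x = a * x)
  (f_derivable : forall n x, (n < 3)%N -> derivable (derive1n n f) x 1)
  (f2_monotonic : monotonic (fun x => `|derive1n 2 f x|))
  (f3_monotonic : monotonic (fun x => `|derive1n 3 f x|))
  (* Sobol' points, Owen's scramblings and the constants C_(eps, d) *)
  (V_sobol : sobol_directions V)
  (xi_owen : fair_bits P
     (fun i : nat * nat * seq bool => xi i.1.1 i.1.2 i.2))
  (C_bound : forall r d eps, (0 < d)%N -> 0 < eps ->
     owen_variance_bound V P (xi r) d eps (C eps d))
  (C_blowup : forall d, (0 < d)%N -> C eps d @[eps --> 0^'+] --> +oo)
  (* standing assumptions, for all discretization parameters 0 < h <= h0 *)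
  (h0_gt0 : 0 < h0) (alpha01 : 0 < alpha < 1)
  (V_GHK_bounded :
     (uniform_sup h0 (fun h => V_GHK (f \o inner_integral (gh h))) < +oo)%E)
  (moment_df_bounded : (uniform_sup h0 (fun h => moment_df f (gh h)) < +oo)%E)
  (moment_ddf_bounded : (uniform_sup h0 (fun h => moment_ddf f (gh h)) < +oo)%E)
  (* (1) *)
  (b_gt0 : 0 < b) (A_range : forall i, 0 < A i < 2^-1)
  (growth : forall h, 0 < h <= h0 -> forall u : {set 'I_d1},
     has_mixed (enum u) (f \o inner_integral (gh h)) /\
     forall z, open_cube d1 z ->
       `|mixed (enum u) (f \o inner_integral (gh h)) z| <=
       b * \prod_(i < d1) (Num.min (tnth z i) (1 - tnth z i))
                            `^ (- A i - (i \in u)%:R))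
  (* (2) *)
  (Cdisc_gt0 : 0 < Cdisc) (eta_gt0 : 0 < eta) (gamma_gt0 : 0 < gamma)
  (bias : forall h, 0 < h <= h0 ->
     (`| outer_integral f (gh h) - outer_integral f g |
        <= (Cdisc * h `^ eta)%:E)%E)
  (cost_bound : forall h y x, 0 < h <= h0 -> cube d1 y -> cube d2 x ->
     0 <= cost h y x <= Cwork * h `^ (- gamma))
  (* (3) *)
  (deltaK01 : 0 < deltaK < 1) (p_ge1 : (1 <= p)%E)
  (sobolev3 : forall h K, 0 < h <= h0 -> 1 - deltaK < K < 1 + deltaK ->
     sobolev_space 3 p (fun y => f (K * inner_integral (gh h) y)))
  (* (4), and the bound shared with (6) *)
  (k_ge0 : 0 <= k)
  (ratio_bound : forall h, 0 < h <= h0 ->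
     (ereal_sup [set `| V_GHK (gh h y) / (inner_integral (gh h) y)%:E |
                | y in cube d1] <= k%:E)%E)
  (q_ge1 : (1 <= q)%E) (pq : (p^-1 + q^-1 = 1)%E)
  (gbar_L3q : forall h, 0 < h <= h0 ->
     Lp_cube (3%:E * q)%E (inner_integral (gh h)))
  (* (5) *)
  (deltaK'01 : 0 < deltaK' < 1) (p'_ge1 : (1 <= p')%E)
  (sobolev2 : forall h K, 0 < h <= h0 -> 1 - deltaK' < K < 1 + deltaK' ->
     sobolev_space 2 (2%:E * p')%E (fun y => f (K * inner_integral (gh h) y)))
  (* (6) *)
  (q'_ge1 : (1 <= q')%E) (p'q' : (p'^-1 + q'^-1 = 1)%E)
  (gbar_L4q' : forall h, 0 < h <= h0 ->
     Lp_cube (4%:E * q')%E (inner_integral (gh h))) :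
  let prog eps := rDLQ_program f gh C h0 k Cdisc eta gamma alpha eps in
  let TOL_power eps TOL := TOL `^ (- work_exponent eps eta gamma) in
  exists2 eps0 : R, 0 < eps0 &
  (exists K : R -> R,
     [/\ K eps @[eps --> 0^'+] --> +oo,
         forall eps, 0 < eps < eps0 -> \forall TOL \near 0^'+,
           (optimal_value (prog eps) TOL <= (K eps * TOL_power eps TOL)%:E)%E &
         forall eps, 0 < eps < eps0 -> \forall TOL \near 0^'+,
           forall N M h kappa, optimal (prog eps) TOL N M h kappa ->
           forall w : Omega,
             rDLQ_work V (fun r j s => xi r j s w) (cost h) N M
               <= K eps * TOL_power eps TOL]) /\
  (* the blow-up is that of every admissible constant, unless one of the
     factors of C_Q1 and C_Q2 vanishes identically *)
  ((0 < uniform_sup h0 (fun h => V_GHK (f \o inner_integral (gh h))))%E ->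
   (0 < uniform_sup h0 (fun h => moment_df f (gh h)))%E -> 0 < k ->
   forall K : R -> R,
     (forall eps, 0 < eps < eps0 -> \forall TOL \near 0^'+,
        (optimal_value (prog eps) TOL <= (K eps * TOL_power eps TOL)%:E)%E) ->
     K eps @[eps --> 0^'+] --> +oo).
Proof.
move=> prog TOL_power; exists 2^-1; first by rewrite invr_gt0.
have /andP[alpha0 /ltW alpha1] := alpha01.
have wp eps : eps < 2^-1 -> well_posed (prog eps).
  exact: rDLQ_well_posed.
have expE eps : eps < 2^-1 ->
    program_exponent (prog eps) = work_exponent eps eta gamma.
  exact: rDLQ_exponent.
split; last first.
  move=> V0 df0 k0 K K_bound.
  have : lower_constant (prog eps) @[eps --> 0^'+] --> +oo.
    apply: rDLQ_lower_constant_cvg => //; rewrite ?alpha0 ?V0 ?df0//.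
    - exact: C_blowup.
    - exact: C_blowup.
  move=> /cvgryPge lower_oo; apply/cvgryPge => B; near=> eps.
  have eps0 : 0 < eps by near: eps; exact: nbhs_right_gt.
  have eps2 : eps < 2^-1 by near: eps; apply: nbhs_right_lt; rewrite invr_gt0.
  have eps02 : 0 < eps < 2^-1 by rewrite eps0.
  apply: (@le_trans _ _ (lower_constant (prog eps))).
    by near: eps; exact: lower_oo.
  (* both bounds carry the same power of TOL: one tolerance compares them *)
  near (0:R)^'+ => TOL.
  have T0 : 0 < TOL by near: TOL; exact: nbhs_right_gt.
  have upper :
      (optimal_value (prog eps) TOL <= (K eps * TOL_power eps TOL)%:E)%E.
    by near: TOL; exact: K_bound.
  have := le_trans (optimal_value_ge (wp _ eps2) T0) upper.
  by rewrite lee_fin expE// ler_pM2r// powR_gt0.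
(* the term in eps^-1 makes the constant diverge even when C1 and C2 vanish *)
exists (fun eps => upper_constant (prog eps) * (1 + `|Cwork|) + `|eps|^-1).
have upper_le eps c TOL : 0 <= c <= 1 + `|Cwork| -> eps < 2^-1 ->
    c * (upper_constant (prog eps) * TOL `^ (- program_exponent (prog eps))) <=
    (upper_constant (prog eps) * (1 + `|Cwork|) + `|eps|^-1) *
    TOL_power eps TOL.
  move=> /andP[c0 c1] eps2; rewrite expE// mulrA ler_wpM2r ?powR_ge0//.
  rewrite mulrC.
  apply: (@le_trans _ _ (upper_constant (prog eps) * (1 + `|Cwork|))).
    by rewrite ler_wpM2l// upper_constant_ge0//; exact: wp.
  by rewrite lerDl invr_ge0.
split.
- apply/cvgryPge => B; near=> eps.
  have eps0 : 0 < eps by near: eps; exact: nbhs_right_gt.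
  have eps2 : eps < 2^-1 by near: eps; apply: nbhs_right_lt; rewrite invr_gt0.
  have epsB : eps <= (1 + `|B|)^-1.
    by near: eps; apply: nbhs_right_le; rewrite invr_gt0 ltr_wpDr.
  apply: (@le_trans _ _ `|eps|^-1); last first.
    by rewrite lerDr mulr_ge0 ?addr_ge0// upper_constant_ge0//; exact: wp.
  rewrite gtr0_norm//; apply: (@le_trans _ _ (1 + `|B|)).
    by apply: le_trans (ler_norm B) _; rewrite lerDr.
  by rewrite -[leLHS]invrK lef_pV2// posrE invr_gt0 ltr_wpDr.
- move=> eps /andP[eps0 eps2]; near=> TOL.
  have T01 : 0 < TOL <= 1.
    by apply/andP; split; near: TOL; [exact: nbhs_right_gt|exact: nbhs_right_le].
  apply: le_trans (optimal_value_le (wp _ eps2) T01) _.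
  by rewrite lee_fin -[leLHS]mul1r upper_le// ler01 lerDl normr_ge0.
- move=> eps /andP[eps0 eps2]; near=> TOL => N M h kappa opt w.
  have T0 : 0 < TOL by near: TOL; exact: nbhs_right_gt.
  have T01 : 0 < TOL <= 1 by rewrite T0; near: TOL; exact: nbhs_right_le.
  have Th0 : TOL < Cdisc * h0 `^ eta.
    by near: TOL; apply: nbhs_right_lt; rewrite mulr_gt0// powR_gt0.
  have h_gt0 : 0 < h by case: opt => -[].
  have h_lt : h < h0 := feasible_mesh_lt (wp _ eps2) h0_gt0 T0 Th0 opt.1.
  have h_range : 0 < h <= h0 by rewrite h_gt0 ltW.
  apply: (@le_trans _ _ (N%:R * M%:R * (`|Cwork| * h `^ (- gamma)))).
    apply: rDLQ_work_le => y x cy cx.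
    have /andP[_ /le_trans] := cost_bound h y x h_range cy cx; apply.
    by rewrite ler_wpM2r ?powR_ge0// ler_norm.
  rewrite mulrCA; apply: (le_trans _ (upper_le _ `|Cwork| _ _ eps2)); last first.
    by rewrite normr_ge0 lerDr ler01.
  by rewrite ler_wpM2l// (optimal_objective_le (wp _ eps2) T01 opt).
Unshelve. all: by end_near.
Qed.
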